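(* Let $X,Y\in\mathbb{E}$ and let $e,e'$ be arithmetic expressions. Then (1) $[e\mapsto e']\star\mathbf{size}=[e\hookrightarrow e']\cdot(\mathbf{size}-1)$; (2) $[e\mapsto e']\mathbin{-\!\!\star}\mathbf{size}=1+\mathbf{size}+[e\hookrightarrow -]\cdot\infty$; (3) $(X\star Y)\cdot\mathbf{size}\preceq(X\cdot\mathbf{size})\star Y+X\star(Y\cdot\mathbf{size})$; (4) $(X\star Y)\cdot\mathbf{size}=(X\cdot\mathbf{size})\star Y+X\star(Y\cdot\mathbf{size})$ if $X$ or $Y$ is domain-exact.
   Context: States are pairs $(s,h)$ of a stack $s:\mathrm{Vars}\to\mathbb{Z}$ and a heap $h$, i.e. a map $h:N\to\mathbb{Z}$ with $N=\mathrm{dom}(h)\subseteq\mathbb{N}_{>0}$ finite; $\Sigma$ is the set of states. Heaps $h_1,h_2$ are disjoint ($h_1\perp h_2$) if their domains are, and $h_1\star h_2$ is then their union. $s(e)$ is the value of expression $e$ under $s$. $\mathbb{E}$ is the set of functions $\Sigma\to\mathbb{R}_{\ge0}\cup\{\infty\}$ ordered pointwise by $\preceq$; arithmetic is pointwise with $0\cdot\infty=0$. $(X\star Y)(s,h)=\max\{X(s,h_1)\cdot Y(s,h_2)\mid h=h_1\star h_2\}$; for a predicate $\varphi$ with indicator $[\varphi]$, $([\varphi]\mathbin{-\!\!\star}X)(s,h)=\inf\{X(s,h\star h')\mid h'\perp h,\ (s,h')\models\varphi\}$ with $\inf\emptyset=\infty$. $[e\mapsto e'](s,h)=1$ iff $\mathrm{dom}(h)=\{s(e)\}$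 and $h(s(e))=s(e')$, else $0$; $[e\mapsto -](s,h)=1$ iff $\mathrm{dom}(h)=\{s(e)\}$, else $0$; $[e\hookrightarrow e']=[e\mapsto e']\star 1$ and $[e\hookrightarrow -]=[e\mapsto -]\star 1$ (where $1$ is the constant function). $\mathbf{size}(s,h)=|\mathrm{dom}(h)|$. $X$ is domain-exact if for every stack $s$ and heaps $h,h'$, $X(s,h)>0$ and $X(s,h')>0$ imply $\mathrm{dom}(h)=\mathrm{dom}(h')$.
   Formalization: Part (2) is proved at states (s,h) with s(e) > 0; where s(e) ≤ 0 it fails as stated, since no heap satisfies e ↦ e', so the left side is inf ∅ = ∞ while the right side is the finite value 1 + size. *)

(* Defs.v *)
From HB Require Import structures.
From mathcomp Require Import all_boot all_order all_algebra.
From mathcomp Require Import finmap.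
From mathcomp Require Import all_classical all_reals ereal numfun.

Set Implicit Arguments.
Unset Strict Implicit.
Unset Printing Implicit Defensive.
Import Order.TTheory GRing.Theory Num.Theory.

Local Open Scope classical_set_scope.
Local Open Scope ring_scope.
Local Open Scope ereal_scope.

Definition loc : Type := {n : nat | (0 < n)%N}.
HB.instance Definition _ := Choice.on loc.

Definition stack (Vars : Type) : Type := Vars -> int.

Definition heap : Type := {fmap loc -> int}.

Definition state (Vars : Type) : Type := (stack Vars * heap)%type.

(* Expressions are identified with their semantics s |-> s(e), so that a      *)
(* statement quantified over [aexpr] covers every expression syntax whose     *)
(* evaluation does not depend on the heap.                                    *)
Definition aexpr (Vars : Type) : Type := stack Vars -> int.

Definition heap_disjoint (h1 h2 : heap) : Prop :=
  [disjoint domf h1 & domf h2]%fset.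

(* [catf] is right-biased; it is only used on disjoint heaps.                 *)
Definition heap_union (h1 h2 : heap) : heap := catf h1 h2.

Section QSL.
Context (R : realType) (Vars : Type).

(* The nonnegativity of quantities is kept as the separate predicate          *)
(* [expectation], because [size - 1] may take the value -1.                   *)
Definition quantity : Type := state Vars -> \bar R.

Definition expectation (X : quantity) : Prop := forall sh, 0 <= X sh.

Definition iverson (phi : set (state Vars)) : quantity :=
  fun sh => (\1_phi sh)%:E.

(* The supremum ranges over a finite nonempty set, so that it is a maximum:   *)
(* see [sepcon_attained] below.                                               *)
Definition sepcon (X Y : quantity) : quantity := fun sh =>
  ereal_sup [set r | exists h1 h2, [/\ heap_disjoint h1 h2,
    sh.2 = heap_union h1 h2 & r = X (sh.1, h1) * Y (sh.1, h2)]].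

Definition sepimp (phi : set (state Vars)) (X : quantity) : quantity :=
  fun sh => ereal_inf [set r | exists h', [/\ heap_disjoint h' sh.2,
    phi (sh.1, h') & r = X (sh.1, heap_union sh.2 h')]].

(* If [e sh.1] is not positive it is not a location, no heap satisfies        *)
(* [pointsto e e'], and [sepimp (pointsto e e') X sh = +oo] while             *)
(* [contains_allocated e sh = 0].                                             *)
Definition pointsto (e e' : aexpr Vars) : set (state Vars) :=
  [set sh | exists l : loc, [/\ (val l)%:Z = e sh.1,
    domf sh.2 = [fset l]%fset & (sh.2.[? l])%fmap = Some (e' sh.1)]].

Definition allocated (e : aexpr Vars) : set (state Vars) :=
  [set sh | exists l : loc, (val l)%:Z = e sh.1 /\ domf sh.2 = [fset l]%fset].

Definition contains_pointsto (e e' : aexpr Vars) : quantity :=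
  sepcon (iverson (pointsto e e')) (cst 1).

Definition contains_allocated (e : aexpr Vars) : quantity :=
  sepcon (iverson (allocated e)) (cst 1).

Definition hsize : quantity := fun sh => (#|` domf sh.2|%fset)%:R%:E.

Definition domain_exact (X : quantity) : Prop :=
  forall (s : stack Vars) (h h' : heap),
    0 < X (s, h) -> 0 < X (s, h') -> domf h = domf h'.

Lemma sepcon_attained (X Y : quantity) (s : stack Vars) (h : heap) :
  exists h1 h2, [/\ heap_disjoint h1 h2, h = heap_union h1 h2 &
    sepcon X Y (s, h) = X (s, h1) * Y (s, h2)].
Proof.
pose F (D : fpowerset (domf h)) :=
  X (s, h.[& val D]%fmap) * Y (s, h.[\ val D]%fmap).
have D0P : fset0 \in fpowerset (domf h) by rewrite fpowersetE fsub0set.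
pose D0 : fpowerset (domf h) := [` D0P]%fset.
case: (@Order.TotalTheory.arg_maxP _ _ _ D0 xpredT F isT) => D _ Dmax.
exists h.[& val D]%fmap, h.[\ val D]%fmap.
have dis : heap_disjoint h.[& val D]%fmap h.[\ val D]%fmap.
  apply/fdisjointP => x; rewrite domf_restrict domf_rem in_fsetI in_fsetD.
  by case: (x \in val D).
have cat : h = heap_union h.[& val D]%fmap h.[\ val D]%fmap.
  apply/fmapP => x; rewrite fnd_cat fnd_rem fnd_restrict domf_rem in_fsetD.
  by case: (x \in val D) => //=; case: ifPn => // /not_fnd ->.
split=> //; apply/eqP; rewrite eq_le; apply/andP; split.
  apply: ge_ereal_sup => _ [h1 [h2 [d12 /= e12 ->]]].
  have D1P : domf h1 \in fpowerset (domf h).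
    by rewrite fpowersetE e12 /heap_union domf_cat fsubsetUl.
  have := Dmax [` D1P]%fset isT; rewrite /F /=.
  suff [-> ->] : h.[& domf h1]%fmap = h1 /\ h.[\ domf h1]%fmap = h2 by [].
  have n12 x : x \in domf h1 -> x \notin domf h2 by move/fdisjointP: d12; exact.
  split; apply/fmapP => x.
    rewrite fnd_restrict e12 /heap_union fnd_cat.
    by case: ifPn => [/n12/negbTE -> //|/not_fnd ->].
  rewrite fnd_rem e12 /heap_union fnd_cat.
  case: ifPn => [/n12/not_fnd -> //|x1].
  by case: ifPn => // /not_fnd ->; rewrite (not_fnd x1).
by apply: ereal_sup_ubound; exists h.[& val D]%fmap, h.[\ val D]%fmap.
Qed.

End QSL.

Arguments hsize {R Vars}.
Arguments iverson {R Vars}.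
Arguments contains_pointsto {R Vars}.
Arguments contains_allocated {R Vars}.

(* Main.v *)
Require Import Defs.
From mathcomp Require Import all_boot all_order all_algebra.
From mathcomp Require Import finmap.
From mathcomp Require Import all_classical all_reals ereal numfun.

(** Size is additive over disjoint unions, and a maximising decomposition of
    the heap exists for every separating conjunction.  Thus (3) is read off a
    maximiser of [X * Y].  For (4), if maximisers of the two summands both have
    nonzero value, exactness forces them to cut the heap along the same domain,
    hence to be the same decomposition, where the summands add up to
    [X * Y * size]; if one summand vanishes, the other is bounded directly. *)

Set Implicit Arguments.
Unset Strict Implicit.
Unset Printing Implicit Defensive.
Import Order.TTheory GRing.Theory Num.Theory.

Local Open Scope ring_scope.
Local Open Scope ereal_scope.

(** On disjoint heaps the left part is the restriction of the union to its own domain and the right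
    part is what remains, so the left domain alone pins down both. *)
Lemma heap_union_injl (h1 h2 h1' h2' : heap) :
  heap_disjoint h1 h2 -> heap_disjoint h1' h2' ->
  heap_union h1 h2 = heap_union h1' h2' -> domf h1 = domf h1' ->
  h1 = h1' /\ h2 = h2'.
Proof.
move=> d d' /fmapP E D.
have n12 x : x \in domf h1 -> x \notin domf h2 by move/fdisjointP: d; exact.
have n12' x : x \in domf h1 -> x \notin domf h2'.
  by rewrite D; move/fdisjointP: d'; exact.
split; apply/fmapP => x; move: (E x); rewrite !fnd_cat;
  have [x1|x1] := boolP (x \in domf h1).
- by rewrite (negbTE (n12 _ x1)) (negbTE (n12' _ x1)).
- by rewrite (not_fnd x1); rewrite D in x1; rewrite (not_fnd x1).
- by rewrite (not_fnd (n12 _ x1)) (not_fnd (n12' _ x1)).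
- have x1' := x1; rewrite D in x1'; rewrite (not_fnd x1) (not_fnd x1').
  by do 2!case: ifPn => [_|/not_fnd ->].
Qed.

(** By disjointness the left domain is that of the union minus the right one. This lets exactness of
    the right factor stand in for exactness of the left one. *)
Lemma heap_union_domfl (h1 h2 h1' h2' : heap) :
  heap_disjoint h1 h2 -> heap_disjoint h1' h2' ->
  heap_union h1 h2 = heap_union h1' h2' -> domf h2 = domf h2' ->
  domf h1 = domf h1'.
Proof.
move=> d d' E D; apply/fsetP => x.
have : (x \in domf (heap_union h1 h2)) = (x \in domf (heap_union h1' h2')).
  by rewrite E.
rewrite !domf_cat !in_fsetU -D.
move/fdisjointP: d => /(_ x); move/fdisjointP: d' => /(_ x); rewrite -D.
case: (x \in domf h1); case: (x \in domf h1'); case: (x \in domf h2) => //=.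
by move=> _ /(_ isT).
Qed.

Section QuantitativeSeparationLogic.
Context (R : realType) (Vars : Type).
Implicit Types (X Y : quantity R Vars) (s : stack Vars) (sh : state Vars).
Implicit Types (phi : set (state Vars)) (e : aexpr Vars) (h : heap).

Lemma hsize_ge0 : expectation (@hsize R Vars).
Proof. by move=> sh; rewrite lee_fin ler0n. Qed.

Lemma cst1_ge0 : expectation (cst 1 : quantity R Vars).
Proof. by move=> sh; exact: lee01. Qed.

Lemma hsize_union s h1 h2 : heap_disjoint h1 h2 ->
  @hsize R Vars (s, heap_union h1 h2) = hsize (s, h1) + hsize (s, h2).
Proof.
move=> d; rewrite /hsize /heap_union domf_cat cardfsU.
by move: d; rewrite /heap_disjoint -fsetI_eq0 => /eqP ->;
  rewrite cardfs0 subn0 natrD EFinD.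
Qed.

Lemma sepcon_ub X Y s h1 h2 : heap_disjoint h1 h2 ->
  X (s, h1) * Y (s, h2) <= sepcon X Y (s, heap_union h1 h2).
Proof. by move=> d; apply: ereal_sup_ubound; exists h1, h2. Qed.

Lemma sepcon_ge0 X Y : expectation X -> expectation Y ->
  expectation (sepcon X Y).
Proof.
move=> X0 Y0 [s h]; have [h1 [h2 [_ _ ->]]] := sepcon_attained X Y s h.
exact: mule_ge0.
Qed.

Lemma sepcon_hsize_le X Y sh : expectation X -> expectation Y ->
  sepcon X Y sh * hsize sh
  <= sepcon (X \* hsize) Y sh + sepcon X (Y \* hsize) sh.
Proof.
move=> X0 Y0; case: sh => s h.
have [h1 [h2 [d -> ->]]] := sepcon_attained X Y s h.
rewrite hsize_union// ge0_muleDr ?hsize_ge0//.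
apply: leeD; last by rewrite -muleA; exact: (@sepcon_ub X (Y \* hsize)).
by rewrite muleAC; exact: (@sepcon_ub (X \* hsize) Y).
Qed.

(** Equality of the left domains is demanded only when all four values are positive, a premise that
    exactness of either [X] or [Y] can discharge. *)
Lemma decompositions_le_sepcon_hsize X Y s h1 h2 h1' h2' :
  expectation X -> expectation Y ->
  heap_disjoint h1 h2 -> heap_disjoint h1' h2' ->
  heap_union h1 h2 = heap_union h1' h2' ->
  (0 < X (s, h1) -> 0 < X (s, h1') -> 0 < Y (s, h2) -> 0 < Y (s, h2') ->
   domf h1 = domf h1') ->
  X (s, h1) * Y (s, h2) * hsize (s, h1)
    + X (s, h1') * Y (s, h2') * hsize (s, h2')
  <= sepcon X Y (s, heap_union h1 h2) * hsize (s, heap_union h1 h2).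
Proof.
move=> X0 Y0 d d' E ex.
have S0 := sepcon_ge0 X0 Y0; have n0 := hsize_ge0.
have [p|] := boolP (0 < X (s, h1) * Y (s, h2)); last first.
  (* The other product is at most the maximum, and [h2'] is no larger than the whole heap. *)
  rewrite lt0e mule_ge0// andbT negbK => /eqP ->; rewrite mul0e add0e E.
  apply: lee_pmul; rewrite ?mule_ge0//; first exact: sepcon_ub.
  by rewrite hsize_union// leeDr.
have [p'|] := boolP (0 < X (s, h1') * Y (s, h2')); last first.
  rewrite lt0e mule_ge0// andbT negbK => /eqP ->; rewrite mul0e adde0.
  apply: lee_pmul; rewrite ?mule_ge0//; first exact: sepcon_ub.
  by rewrite hsize_union// leeDl.
have pos (x y : \bar R) : 0 <= x -> 0 <= y -> 0 < x * y -> 0 < x /\ 0 < y.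
  by move=> x0 y0; rewrite !lt0e x0 y0 mule_eq0 negb_or => /andP[/andP[-> ->]].
have [x1 y1] := pos _ _ (X0 _) (Y0 _) p.
have [x2 y2] := pos _ _ (X0 _) (Y0 _) p'.
have [<- <-] := heap_union_injl d d' E (ex x1 x2 y1 y2).
by rewrite -ge0_muleDr// -hsize_union// lee_wpmul2r// sepcon_ub.
Qed.

Lemma sepcon_hsizeE X Y : expectation X -> expectation Y ->
  domain_exact X \/ domain_exact Y ->
  sepcon X Y \* hsize = sepcon (X \* hsize) Y \+ sepcon X (Y \* hsize).
Proof.
move=> X0 Y0 ex; apply/funext => -[s h]; apply/eqP; rewrite eq_le.
rewrite sepcon_hsize_le//=.
have [h1 [h2 [d E ->]]] := sepcon_attained (X \* hsize) Y s h.
have [h1' [h2' [d' E' ->]]] := sepcon_attained X (Y \* hsize) s h.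
rewrite muleAC muleA E; apply: decompositions_le_sepcon_hsize => //.
  by rewrite -E.
move=> x1 x2 y1 y2; case: ex => ex; first exact: ex x1 x2.
by apply: heap_union_domfl d d' _ (ex _ _ _ y1 y2); rewrite -E.
Qed.

Lemma iversonT phi sh : phi sh -> @iverson R Vars phi sh = 1.
Proof. by move=> p; rewrite /iverson indicE mem_set. Qed.

Lemma iversonF phi sh : ~ phi sh -> @iverson R Vars phi sh = 0.
Proof. by move=> p; rewrite /iverson indicE memNset. Qed.

Lemma sepcon_iverson0 phi Y s h :
  (forall h1 h2, heap_disjoint h1 h2 -> h = heap_union h1 h2 ->
    ~ phi (s, h1)) ->
  sepcon (iverson phi) Y (s, h) = 0.
Proof.
move=> N; have [h1 [h2 [d E ->]]] := sepcon_attained (iverson phi) Y s h.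
by rewrite iversonF ?mul0e//; exact: N E.
Qed.

(** When [phi] fixes the domain, at most one split of the heap has a left part satisfying it, so the
    maximum collapses to one value. Every other split contributes 0, which is below that value since
    [Y] is nonnegative. *)
Lemma sepcon_iverson phi Y s h1 h2 :
  (forall h, phi (s, h) -> domf h = domf h1) -> expectation Y ->
  heap_disjoint h1 h2 -> phi (s, h1) ->
  sepcon (iverson phi) Y (s, heap_union h1 h2) = Y (s, h2).
Proof.
move=> ex Y0 d p; apply/eqP; rewrite eq_le; apply/andP; split; last first.
  by have := sepcon_ub (iverson phi) Y s d; rewrite iversonT// mul1e.
have [k1 [k2 [d' E ->]]] :=
  sepcon_attained (iverson phi) Y s (heap_union h1 h2).
have [q|q] := pselect (phi (s, k1)); last by rewrite iversonF// mul0e.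
have [_ <-] := heap_union_injl d d' E (esym (ex _ q)).
by rewrite iversonT// mul1e.
Qed.

(** The stack alone determines the location. This supplies the fixed-domain premise of
    [sepcon_iverson], for [allocated] and, through the next lemma, for [pointsto]. *)
Lemma allocated_domf e s h h' :
  allocated e (s, h) -> allocated e (s, h') -> domf h = domf h'.
Proof.
move=> [l [/= L ->]] [l' [/= L' ->]]; congr fset1; apply: val_inj.
by apply/eqP; rewrite -eqz_nat L L'.
Qed.

Lemma pointsto_allocated e e' s h : pointsto e e' (s, h) -> allocated e (s, h).
Proof. by move=> [l [L D _]]; exists l. Qed.

Lemma hsize_allocated e s h : allocated e (s, h) -> @hsize R Vars (s, h) = 1.
Proof. by move=> [l [_ D]]; rewrite /hsize D cardfs1. Qed.

(** If a matching cell can be split off, what remains has exactly one cell fewer than the heap.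
    Otherwise both sides are 0, even on the empty heap, where the factor -1 is multiplied by 0. *)
Lemma sepcon_pointsto_hsize e e' :
  sepcon (iverson (pointsto e e')) hsize
  = contains_pointsto e e' \* (hsize \- cst 1) :> quantity R Vars.
Proof.
apply/funext => -[s h] /=; rewrite /contains_pointsto.
have [[h1 [h2 [d E p]]]|N] := pselect (exists h1 h2, [/\ heap_disjoint h1 h2,
    h = heap_union h1 h2 & pointsto e e' (s, h1)]); last first.
  by rewrite !sepcon_iverson0 ?mul0e// => h1 h2 d E p; apply: N; exists h1, h2.
have ex h' : pointsto e e' (s, h') -> domf h' = domf h1.
  move=> /pointsto_allocated q; apply: allocated_domf q _.
  exact: pointsto_allocated p.
rewrite E (sepcon_iverson ex hsize_ge0 d p) (sepcon_iverson ex cst1_ge0 d p).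
rewrite mul1e hsize_union// (hsize_allocated (pointsto_allocated p)).
by rewrite /= addeAC subee// add0e.
Qed.

(** Positivity turns [e sh.1] into a location [l]. If [l] is in the heap, both sides are infinite;
    if it is free, every admissible extension adds exactly one cell. *)
Lemma sepimp_pointsto_hsize e e' sh : (0 < e sh.1)%R ->
  sepimp (pointsto e e') hsize sh
  = 1 + hsize sh + contains_allocated e sh * +oo :> \bar R.
Proof.
case: sh => s h /= e0.
have [l L] : exists l : loc, (val l)%:Z = e s.
  by case: (e s) e0 => // n n0; exists (exist _ n n0).
have locE (l' : loc) : (val l')%:Z = e s -> l' = l.
  by rewrite -L => -[] /val_inj.
rewrite /contains_allocated; have [lh|lh] := boolP (l \in domf h).
  (* Cutting [h] into its cell at [l] and the rest shows that [contains_allocated] is 1 here, so the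
     right-hand side is [+oo]. *)
  have ah : allocated e (s, h.[& [fset l]%fset]%fmap).
    exists l; split => //; rewrite domf_restrict; apply/fsetIidPl.
    by rewrite fsub1set.
  have d : heap_disjoint h.[& [fset l]%fset]%fmap h.[\ [fset l]%fset]%fmap.
    apply/fdisjointP => x; rewrite domf_restrict domf_rem in_fsetI in_fsetD.
    by case: (x \in [fset l]%fset).
  have E : h = heap_union h.[& [fset l]%fset]%fmap h.[\ [fset l]%fset]%fmap.
    apply/fmapP => x; rewrite fnd_cat fnd_rem fnd_restrict domf_rem in_fsetD.
    case: (x \in [fset l]%fset) => //=.
    by case: ifPn => // /not_fnd ->.
  rewrite [X in sepcon _ _ (s, X)]E.
  have ex h' (q : allocated e (s, h')) := allocated_domf q ah.
  rewrite (sepcon_iverson ex cst1_ge0 d ah).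
  rewrite mul1e addey// /sepimp.
  (* An admissible extension would have [l] in its domain and thus overlap [h], so the infimum is
     over the empty set. *)
  rewrite (_ : [set r | _]%classic = set0) ?ereal_inf0//.
  rewrite -subset0 => r [h' [/fdisjointP d' [l' [/= /locE -> D _]] _]].
  by have := d' l; rewrite D lh in_fset1 eqxx => /(_ isT).
(* Now [l] is free in [h], so no part of [h] is allocated at [e], and the infinite term becomes 0
   times [+oo], which is 0. *)
rewrite sepcon_iverson0; last first.
  move=> h1 h2 _ E [l' [/= /locE -> D]].
  by move: lh; rewrite E domf_cat in_fsetU D in_fset1 eqxx.
rewrite mul0e adde0.
(* The one-cell heap [h0] shows that some extension is admissible, and [sz] that all of them give
   the same size; hence the infimum is over a singleton. *)
pose h0 : heap := [fmap].[l <- e' s]%fmap.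
have D0 : domf h0 = [fset l]%fset by rewrite dom_setf domf0 fsetU0.
have p0 : pointsto e e' (s, h0).
  by exists l; split => //; rewrite fnd_set eqxx.
have sz h' : heap_disjoint h' h -> pointsto e e' (s, h') ->
    @hsize R Vars (s, heap_union h h') = 1 + hsize (s, h).
  move=> d /pointsto_allocated a; rewrite hsize_union.
    by rewrite (hsize_allocated a) addeC.
  by rewrite /heap_disjoint fdisjoint_sym.
rewrite /sepimp.
rewrite (_ : [set r | _]%classic = [set 1 + hsize (s, h)]%classic).
  by rewrite ereal_inf1.
apply/seteqP; split=> [r [h' [d p ->]]|_ ->]; first exact: sz.
have d0 : heap_disjoint h0 h.
  by apply/fdisjointP => x; rewrite D0 in_fset1 => /eqP ->.
by exists h0; split => //; rewrite sz.
Qed.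

End QuantitativeSeparationLogic.

Theorem theorem3p13 (R : realType) (Vars : Type) (X Y : quantity R Vars)
    (e e' : aexpr Vars) (X0 : expectation X) (Y0 : expectation Y) :
  [/\ sepcon (iverson (pointsto e e')) hsize
      = contains_pointsto e e' \* (hsize \- cst 1) :> quantity R Vars,
      forall sh : state Vars, (0 < e sh.1)%R ->
        sepimp (pointsto e e') hsize sh
        = 1 + hsize sh + contains_allocated e sh * +oo :> \bar R,
      forall sh : state Vars,
        sepcon X Y sh * hsize sh
        <= sepcon (X \* hsize) Y sh + sepcon X (Y \* hsize) sh
    & domain_exact X \/ domain_exact Y ->
        sepcon X Y \* hsize
        = sepcon (X \* hsize) Y \+ sepcon X (Y \* hsize)].
Proof.
split.
- exact: sepcon_pointsto_hsize.
- by move=> sh; exact: sepimp_pointsto_hsize.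
- by move=> sh; exact: sepcon_hsize_le.
- exact: sepcon_hsizeE.
Qed.
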